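(* For all $1\le k\le n$, the formula $$\Theta^*_{n,k}:=\Big[\bigotimes_{i,j<n}((p_{i,j}\wedge1)\vee(q_{i,j}\wedge1))\Big]\setminus\Big(\Big[\bigotimes_{i<n,\,l<k}((s_{i,l}\wedge1)\vee(s'_{i,l}\wedge1))\setminus\alpha^k_n(\bar p,\bar s,\bar s')\Big]\vee\Big[\bigotimes_{i<n,\,l<k+1}((r_{i,l}\wedge1)\vee(r'_{i,l}\wedge1))\setminus\beta^{k+1}_n(\bar q,\bar r,\bar r')\Big]\Big)$$ is provable in $\mathbf{WL}$, i.e. $\mathbf{WL}\vdash(\Rightarrow\Theta^*_{n,k})$.
   Context: **Formulas.** $\bigotimes$ denotes iterated fusion $*$, with indices in lexicographic order. The variables are $p_{i,j},q_{i,j}$ ($0\le i,j<n$), $s_{i,l},s'_{i,l}$ ($0\le i<n$, $0\le l<k$), $r_{i,l},r'_{i,l}$ ($0\le i<n$, $0\le l<k+1$), and $$\alpha^k_n(\bar p,\bar s,\bar s'):=\bigvee_{i<n}\bigwedge_{l<k}s'_{i,l}\ \vee\bigvee_{i,j<n}\bigvee_{l<k}(s_{i,l}\wedge s_{j,l}\wedge p_{i,j}),$$ $$\beta^{k+1}_n(\bar q,\bar r,\bar r'):=\bigvee_{l<k+1}\bigwedge_{i<n}r'_{i,l}\ \vee\bigvee_{i,j<n}\bigvee_{l<m<k+1}(r_{i,l}\wedge r_{j,m}\wedge q_{i,j}).$$ **The calculus $\mathbf{WL}$ (weak Lambek)** over the language $\{1,\bot,\wedge,\vee,*,\setminus\}$.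 Sequents $\Gamma\Rightarrow\Delta$, with $\Gamma$ a finite sequence of formulas and $\Delta$ empty or a single formula. Initial sequents: $\phi\Rightarrow\phi$; $\Rightarrow1$; $\Gamma,\bot,\Sigma\Rightarrow\Delta$. Rules (premises / conclusion): (cut) $\Gamma\Rightarrow\phi$ and $\Sigma,\phi,\Pi\Rightarrow\Delta$ / $\Sigma,\Gamma,\Pi\Rightarrow\Delta$; $(1w)$ $\Gamma,\Sigma\Rightarrow\Delta$ / $\Gamma,1,\Sigma\Rightarrow\Delta$; $(L\wedge)$ $\Gamma,\phi,\Sigma\Rightarrow\Delta$ (or $\Gamma,\psi,\Sigma\Rightarrow\Delta$) / $\Gamma,\phi\wedge\psi,\Sigma\Rightarrow\Delta$; $(R\wedge)$ $\Gamma\Rightarrow\phi$ and $\Gamma\Rightarrow\psi$ / $\Gamma\Rightarrow\phi\wedge\psi$; $(L\vee)$ $\Gamma,\phi,\Sigma\Rightarrow\Delta$ and $\Gamma,\psi,\Sigma\Rightarrow\Delta$ / $\Gamma,\phi\vee\psi,\Sigma\Rightarrow\Delta$; $(R\vee)$ $\Gamma\Rightarrow\phi$ (or $\Gamma\Rightarrow\psi$) / $\Gamma\Rightarrow\phi\vee\psi$; $(L* )$ $\Gamma,\phi,\psi,\Sigma\Rightarrow\Delta$ / $\Gamma,\phi*\psi,\Sigma\Rightarrow\Delta$; $(R* )$ $\Gamma\Rightarrow\phi$ and $\Sigma\Rightarrow\psi$ / $\Gamma,\Sigma\Rightarrow\phi*\psi$; $(R\setminus)$ $\phi,\Gamma\Rightarrow\psi$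 / $\Gamma\Rightarrow\phi\setminus\psi$. (There is no left rule for $\setminus$ and there are no structural rules besides cut.) *)

(* Defs.v *)
From mathcomp Require Import all_boot.

Set Implicit Arguments.
Unset Strict Implicit.
Unset Printing Implicit Defensive.

Inductive formula (V : Type) : Type :=
| Var of V
| One
| Bot
| Meet of formula V & formula V
| Join of formula V & formula V
| Fus of formula V & formula V
| LRes of formula V & formula V.

Arguments One {V}.
Arguments Bot {V}.

Declare Scope wl_scope.
Delimit Scope wl_scope with wl.
Bind Scope wl_scope with formula.

Notation "1" := One : wl_scope.
Notation "\bot" := Bot : wl_scope.
Notation "x '/\' y" := (Meet x y) : wl_scope.
Notation "x '\/' y" := (Join x y) : wl_scope.
Notation "x * y" := (Fus x y) : wl_scope.
Notation "x '\\' y" := (LRes x y) (at level 87, no associativity) : wl_scope.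

Reserved Notation "G =>> D" (at level 90, no associativity).

Section Calculus.

Variable V : Type.
Implicit Types (G S P : seq (formula V)) (D : option (formula V)).
Implicit Types a b : formula V.

Inductive WL : seq (formula V) -> option (formula V) -> Prop :=
| WL_id a : [:: a] =>> Some a
| WL_one : [::] =>> Some 1%wl
| WL_bot G S D : G ++ \bot%wl :: S =>> D
| WL_cut G S P a D :
    G =>> Some a -> S ++ a :: P =>> D -> S ++ G ++ P =>> D
| WL_1w G S D : G ++ S =>> D -> G ++ 1%wl :: S =>> D
| WL_Lmeet1 G S a b D : G ++ a :: S =>> D -> G ++ (a /\ b)%wl :: S =>> D
| WL_Lmeet2 G S a b D : G ++ b :: S =>> D -> G ++ (a /\ b)%wl :: S =>> D
| WL_Rmeet G a b : G =>> Some a -> G =>> Some b -> G =>> Some (a /\ b)%wl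
| WL_Ljoin G S a b D :
    G ++ a :: S =>> D -> G ++ b :: S =>> D -> G ++ (a \/ b)%wl :: S =>> D
| WL_Rjoin1 G a b : G =>> Some a -> G =>> Some (a \/ b)%wl
| WL_Rjoin2 G a b : G =>> Some b -> G =>> Some (a \/ b)%wl
| WL_Lfus G S a b D : G ++ a :: b :: S =>> D -> G ++ (a * b)%wl :: S =>> D
| WL_Rfus G S a b :
    G =>> Some a -> S =>> Some b -> G ++ S =>> Some (a * b)%wl
| WL_Rres G a b : a :: G =>> Some b -> G =>> Some (a \\ b)%wl
where "G =>> D" := (WL G D).

(* Left-nested iteration: [:: a; b; c] gives op (op a b) c, without appending
   the unit e, which is returned for the empty sequence only. *)
Definition iterop1 (op : formula V -> formula V -> formula V) (e : formula V)
    (s : seq (formula V)) : formula V :=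
  if s is x :: s' then foldl op x s' else e.

(* The language has no top constant; Bot \ Bot is a provable top element. *)
Definition bigmeet := iterop1 (@Meet V) (\bot \\ \bot)%wl.
Definition bigjoin := iterop1 (@Join V) \bot%wl.
Definition bigfus := iterop1 (@Fus V) 1%wl.

End Calculus.

Inductive var : Type :=
| vp of nat & nat
| vq of nat & nat
| vs of nat & nat
| vs' of nat & nat
| vr of nat & nat
| vr' of nat & nat.

Definition p i j := Var (vp i j).
Definition q i j := Var (vq i j).
Definition s i l := Var (vs i l).
Definition s' i l := Var (vs' i l).
Definition r i l := Var (vr i l).
Definition r' i l := Var (vr' i l).

Definition alpha (n k : nat) : formula var :=
  (bigjoin [seq bigmeet [seq s' i l | l <- iota 0 k] | i <- iota 0 n]
   \/ bigjoin [seq bigjoin [seq (s i l /\ s j l) /\ p i j | l <- iota 0 k]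
              | i <- iota 0 n, j <- iota 0 n])%wl.

(* The clique parameter is c = k + 1. *)
Definition beta (n c : nat) : formula var :=
  (bigjoin [seq bigmeet [seq r' i l | i <- iota 0 n] | l <- iota 0 c]
   \/ bigjoin [seq bigjoin [seq (r i lm.1 /\ r j lm.2) /\ q i j
                           | lm <- [seq (l, m) | l <- iota 0 c, m <- iota 0 c]
                           & lm.1 < lm.2]
              | i <- iota 0 n, j <- iota 0 n])%wl.

(* [seq E i j | i <- iota 0 n, j <- iota 0 m] lists the E i j with (i, j)
   in lexicographic order. *)
Definition Theta (n k : nat) : formula var :=
  (bigfus [seq (p i j /\ 1) \/ (q i j /\ 1) | i <- iota 0 n, j <- iota 0 n]
   \\
   ((bigfus [seq (s i l /\ 1) \/ (s' i l /\ 1) | i <- iota 0 n, l <- iota 0 k]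
     \\ alpha n k)
    \/
    (bigfus [seq (r i l /\ 1) \/ (r' i l /\ 1)
            | i <- iota 0 n, l <- iota 0 k.+1]
     \\ beta n k.+1)))%wl.

(* Main.v *)
Require Import Defs.
From mathcomp Require Import all_boot.

(** Splitting every factor of the outer fusion chooses [p i j] or [q i j] for
    each [(i, j)], i.e. a directed graph on [n] vertices, loops allowed. If it
    is not [k]-colourable, the left disjunct is provable, because the factors
    [s], [s'] encode attempts at a colouring; if it is, the right one is, because
    by the pigeonhole principle there is no [k + 1]-clique. Either way a disjunct
    of alpha or beta is obtained whose literals all occur in the antecedent. Its
    formulas [x /\ 1] can be weakened away, and no exchange or contraction is
    needed since the right rule for [/\] shares its context. *)

Set Implicit Arguments.
Unset Strict Implicit.
Unset Printing Implicit Defensive.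

Local Notation "G =>> D" := (WL G D).

(** * Derived rules for iterated connectives and unit-bounded formulas *)

Section DerivedRules.

Variable V : Type.
Implicit Types (G S : seq (formula V)) (D : option (formula V)).
Implicit Types a b x : formula V.

Lemma WL_bigfus G S D : G ++ S =>> D -> bigfus G :: S =>> D.
Proof.
case: G => [|x G] /=; first exact: (@WL_1w _ [::]).
rewrite /bigfus /=; elim: G x => [|y G IH] x //= H.
by apply: IH; apply: (@WL_Lfus _ [::]).
Qed.

Section Families.

Variables (I : eqType) (E : I -> formula V).
Implicit Types (t : seq I) (i : I).

Lemma WL_bigjoin G t i :
  i \in t -> G =>> Some (E i) -> G =>> Some (bigjoin [seq E i | i <- t]).
Proof.
(* The join nests to the left, so the induction carries the accumulator [x]: it is provable already,
   or a later entry is. *)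
have key u x : (G =>> Some x) \/ (exists2 j, j \in u & G =>> Some (E j)) ->
    G =>> Some (foldl (@Join V) x [seq E i | i <- u]).
  elim: u x => [|j u IH] x /= [Gx|[j' j'u Gj']] //; apply: IH.
    by left; apply: WL_Rjoin1.
  move: j'u; rewrite inE => /predU1P[<-|j'u]; first by left; apply: WL_Rjoin2.
  by right; exists j'.
case: t => [|j t] //; rewrite inE => it Gi; apply: key.
by case/predU1P: it => [<-|it]; [left | right; exists i].
Qed.

Lemma WL_bigmeet G t :
  {in t, forall i, G =>> Some (E i)} -> G =>> Some (bigmeet [seq E i | i <- t]).
Proof.
case: t => [_|i t Gt]; first by apply: WL_Rres; apply: (@WL_bot _ [::]).
rewrite /bigmeet /=; have: G =>> Some (E i) by apply: Gt; exact: mem_head.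
have {Gt}: {in t, forall j, G =>> Some (E j)}.
  by move=> j jt; apply: Gt; rewrite inE jt orbT.
elim: t (E i) => [|j t IH] x //= Gt Gx; apply: IH.
  by move=> j' j't; apply: Gt; rewrite inE j't orbT.
by apply: WL_Rmeet => //; apply: Gt; exact: mem_head.
Qed.

Lemma WL_weaken G S D t :
  G ++ S =>> D -> G ++ [seq (E i /\ 1)%wl | i <- t] ++ S =>> D.
Proof.
by move=> GS; elim: t => [|i t IH] //=; apply: WL_Lmeet2; apply: WL_1w.
Qed.

Lemma WL_literal t i :
  i \in t -> [seq (E i /\ 1)%wl | i <- t] =>> Some (E i).
Proof.
case/splitPr => t1 t2; rewrite map_cat /=.
apply: (@WL_weaken [::]) => /=; apply: (@WL_Lmeet1 _ [::]) => /=.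
by rewrite -[map _ t2]cats0; apply: (@WL_weaken [:: E i]); apply: WL_id.
Qed.

End Families.

(** The left join rule decides one factor at a time. By [uniq t], independent decisions at the
    positions still form a single function [f]. *)
Lemma WL_split (I : eqType) (a b : I -> formula V) (t : seq I) S D :
  uniq t ->
  (forall f : I -> bool,
     [seq ((if f i then a i else b i) /\ 1)%wl | i <- t] ++ S =>> D) ->
  bigfus [seq ((a i /\ 1) \/ (b i /\ 1))%wl | i <- t] :: S =>> D.
Proof.
move=> ut H; apply: WL_bigfus.
(* [G] collects the factors already decided. *)
suff key u G : uniq u ->
    (forall f : I -> bool,
       G ++ [seq ((if f i then a i else b i) /\ 1)%wl | i <- u] ++ S =>> D) ->
    G ++ [seq ((a i /\ 1) \/ (b i /\ 1))%wl | i <- u] ++ S =>> D.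
  exact: (key t [::]).
elim: u G => [|i u IH] G /=; first by move=> _; apply; exact: xpredT.
move=> /andP[iu uu] {}H.
(* Since [i] is not in [u], setting [f] to [c] at [i] leaves the later choices alone. *)
have upd c (f : I -> bool) :
    [seq ((if (if j == i then c else f j) then a j else b j) /\ 1)%wl | j <- u]
    = [seq ((if f j then a j else b j) /\ 1)%wl | j <- u].
  by apply/eq_in_map => j ju; case: eqP iu => [<-|//]; rewrite ju.
apply: WL_Ljoin; rewrite -cat_rcons; apply: IH => // f; rewrite cat_rcons.
  by have := H (fun j => if j == i then true else f j); rewrite eqxx upd.
by have := H (fun j => if j == i then false else f j); rewrite eqxx upd.
Qed.

End DerivedRules.

(** * Contexts given by a choice at each index pair *)

Definition pairs (m n : nat) : seq (nat * nat) :=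
  [seq (i, j) | i <- iota 0 m, j <- iota 0 n].

Lemma pairs_uniq m n : uniq (pairs m n).
Proof. by apply: allpairs_uniq; rewrite ?iota_uniq // => -[? ?] [? ?]. Qed.

Lemma mem_pairs m n i j : ((i, j) \in pairs m n) = (i < m) && (j < n).
Proof.
apply/allpairsP/andP => [[[i' j'] /=]|[im jn]].
  by rewrite !mem_iota => -[im jn [-> ->]].
by exists (i, j); rewrite !mem_iota.
Qed.

Lemma allpairs_pairs (T : Type) (E : nat -> nat -> T) m n :
  [seq E i j | i <- iota 0 m, j <- iota 0 n] = [seq E x.1 x.2 | x <- pairs m n].
Proof. by rewrite map_allpairs. Qed.

Definition choice_ctx (a b : nat -> nat -> formula var) (f : nat * nat -> bool)
    (m n : nat) : seq (formula var) :=
  [seq ((if f x then a x.1 x.2 else b x.1 x.2) /\ 1)%wl | x <- pairs m n].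

Lemma WL_choices (a b : nat -> nat -> formula var) m n S D :
  (forall f, choice_ctx a b f m n ++ S =>> D) ->
  bigfus [seq ((a i j /\ 1) \/ (b i j /\ 1))%wl
         | i <- iota 0 m, j <- iota 0 n] :: S =>> D.
Proof.
move=> H; rewrite allpairs_pairs.
exact: (WL_split (a := fun x => a x.1 x.2) (pairs_uniq m n)).
Qed.

Section ChoiceContexts.

Variables (a b : nat -> nat -> formula var) (f : nat * nat -> bool).
Variables (m n : nat) (i : 'I_m) (j : 'I_n).

Lemma choice_ctx_literal :
  choice_ctx a b f m n =>> Some (if f (val i, val j) then a i j else b i j).
Proof.
apply: (WL_literal (fun x => if f x then a x.1 x.2 else b x.1 x.2)
  (i := (val i, val j))).
by rewrite mem_pairs !ltn_ord.
Qed.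

Lemma choice_ctx_left a' b' f' m' n' :
  choice_ctx a b f m n ++ choice_ctx a' b' f' m' n' =>>
    Some (if f (val i, val j) then a i j else b i j).
Proof.
rewrite -[X in _ ++ X]cats0.
apply: (WL_weaken (fun x => if f' x then a' x.1 x.2 else b' x.1 x.2)).
by rewrite cats0; exact: choice_ctx_literal.
Qed.

Lemma choice_ctx_right a' b' f' m' n' :
  choice_ctx a' b' f' m' n' ++ choice_ctx a b f m n =>>
    Some (if f (val i, val j) then a i j else b i j).
Proof.
apply: (WL_weaken (fun x => if f' x then a' x.1 x.2 else b' x.1 x.2)
  (G := [::])).
exact: choice_ctx_literal.
Qed.

End ChoiceContexts.

(** * Colourings and cliques of the chosen graph *)

Section Graph.

Variables (n k : nat) (f : nat * nat -> bool).

(** The case [i = j] is included, so a graph with a loop has no proper colouring. *)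
Definition proper_coloring (col : {ffun 'I_n -> 'I_k}) : bool :=
  [forall i, forall j, (col i == col j) ==> ~~ f (val i, val j)].

Lemma WL_alpha g :
  ~~ [exists col, proper_coloring col] ->
  choice_ctx s s' g n k ++ choice_ctx p q f n n =>> Some (alpha n k).
Proof.
move=> ncol; rewrite /alpha allpairs_pairs.
(* Either some vertex [i] gets no colour from [g], and all its [s'] literals are available, or every
   vertex gets one. *)
have [/existsP[i /forallP gi]|] :=
    boolP [exists i : 'I_n, forall l : 'I_k, ~~ g (val i, val l)].
  apply/WL_Rjoin1/(WL_bigjoin (i := val i)); first by rewrite mem_iota ltn_ord.
  apply: WL_bigmeet => l; rewrite mem_iota /= => lk.
  (* The literal is written as a branch of an [if], whose condition then becomes the value of [g],
     to match the choice context. *)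
  rewrite -[s' _ _]/(if false then s i l else s' i l).
  by rewrite -(negPf (gi (Ordinal lk)));
     exact: (choice_ctx_left _ _ _ i (Ordinal lk)).
rewrite negb_exists => /forallP gn.
have /fin_all_exists[c gc] (i : 'I_n) : exists l : 'I_k, g (val i, val l).
  by apply/existsP; have := gn i; rewrite negb_forall;
     under eq_existsb do rewrite negbK.
(* The colouring [c] read off from [g] is not proper: some edge has both ends of one colour. *)
move: ncol; rewrite negb_exists => /forallP/(_ (finfun c)).
rewrite negb_forall => /existsP[i]; rewrite negb_forall => /existsP[j].
rewrite !ffunE negb_imply negbK => /andP[/eqP cij fij].
apply/WL_Rjoin2/(WL_bigjoin (i := (val i, val j))).
  by rewrite mem_pairs !ltn_ord.
apply: (WL_bigjoin (i := val (c i))); first by rewrite mem_iota ltn_ord.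
have gl (v : 'I_n) : choice_ctx s s' g n k ++ choice_ctx p q f n n =>>
    Some (s v (c v)).
  by rewrite -[s _ _]/(if true then _ else s' v (c v)) -(gc v);
     exact: choice_ctx_left.
apply: WL_Rmeet; first by apply: WL_Rmeet; rewrite /= ?[in s j _]cij; exact: gl.
by rewrite /= -[p _ _]/(if true then _ else q i j) -fij;
   exact: choice_ctx_right.
Qed.

Lemma WL_beta g :
  [exists col, proper_coloring col] ->
  choice_ctx r r' g n k.+1 ++ choice_ctx p q f n n =>> Some (beta n k.+1).
Proof.
case/existsP=> col colP; rewrite /beta allpairs_pairs.
(* Either clique position [l] is left empty by [g], or every position [l] holds some vertex
   [c l]. *)
have [/existsP[l /forallP gl]|] :=
    boolP [exists l : 'I_k.+1, forall i : 'I_n, ~~ g (val i, val l)].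
  apply/WL_Rjoin1/(WL_bigjoin (i := val l)); first by rewrite mem_iota ltn_ord.
  apply: WL_bigmeet => i; rewrite mem_iota /= => lin.
  rewrite -[r' _ _]/(if false then r i l else r' i l).
  by rewrite -(negPf (gl (Ordinal lin)));
     exact: (choice_ctx_left _ _ _ (Ordinal lin) l).
rewrite negb_exists => /forallP gn.
have /fin_all_exists[c gc] (l : 'I_k.+1) : exists i : 'I_n, g (val i, val l).
  by apply/existsP; have := gn l; rewrite negb_forall;
     under eq_existsb do rewrite negbK.
(* Pigeonhole: [k.+1] positions, [k] colours. The two positions are ordered because [beta] only has
   pairs with [l < m]. *)
have [l [m [lm clm]]] : exists l m : 'I_k.+1, l < m /\ col (c l) = col (c m).
  have /injectivePn[l [m lm clm]] : ~~ injectiveb (col \o c).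
    by apply/injectiveP => /leq_card; rewrite !card_ord ltnn.
  have [lt_lm|lt_ml|/val_inj eq_lm] := ltngtP l m.
  - by exists l, m.
  - by exists m, l.
  by rewrite eq_lm eqxx in lm.
(* Equal colours exclude an edge, also when [c l = c m], so the outer choice here was [q]. *)
have fF : f (val (c l), val (c m)) = false.
  apply/negbTE; move/forallP/(_ (c l))/forallP/(_ (c m)): colP.
  by rewrite clm eqxx.
have gr (v : 'I_k.+1) : choice_ctx r r' g n k.+1 ++ choice_ctx p q f n n =>>
    Some (r (c v) v).
  by rewrite -[r _ _]/(if true then _ else r' (c v) v) -(gc v);
     exact: choice_ctx_left.
apply/WL_Rjoin2/(WL_bigjoin (i := (val (c l), val (c m)))).
  by rewrite mem_pairs !ltn_ord.
apply: (WL_bigjoin (i := (val l, val m))).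
  by rewrite mem_filter -/(pairs _ _) mem_pairs !ltn_ord /= lm.
apply: WL_Rmeet; first by apply: WL_Rmeet; exact: gr.
rewrite /= -[q _ _]/(if false then p (c l) (c m) else _) -fF.
exact: choice_ctx_right.
Qed.

End Graph.

Theorem theorem4p10 (n k : nat) (hkn : 1 <= k <= n) :
  WL [::] (Some (Theta n k)).
Proof.
apply: WL_Rres; apply: WL_choices => f; rewrite cats0.
(* The disjunct depends on [f] alone: it is fixed before the inner fusion is split. *)
have [col|ncol] := boolP [exists col, proper_coloring (n := n) (k := k) f col].
  by apply: WL_Rjoin2; apply: WL_Rres; apply: WL_choices => g; exact: WL_beta.
by apply: WL_Rjoin1; apply: WL_Rres; apply: WL_choices => g; exact: WL_alpha.
Qed.
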